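(* Let $\Bbbk$ be an algebraically closed field of characteristic $2$, and let $X_0\subset\mathbb{P}^3$ be the Kummer quartic surface associated with a supersingular curve of genus $2$. Then $\mathrm{Bit}(X_0)$ is of bidegree $(1,2)$ in $G_1(\mathbb{P}^3)$, and it consists of a trope (that is, the $\beta$-plane of lines contained in the trope plane) and a quadric cone.
   Context: $G_1(\mathbb{P}^3)$ is the Grassmannian of lines in $\mathbb{P}^3$, embedded in $\mathbb{P}^5$ by Plücker. A congruence of lines is a surface $F\subset G_1(\mathbb{P}^3)$. Its bidegree is $(m,n)$, where the order $m$ is the number of lines of $F$ through a general point of $\mathbb{P}^3$ and the class $n$ is the number of lines of $F$ contained in a general plane. A line $\ell$ is a bitangent line of a normal surface $X\subset\mathbb{P}^3$ if either $\ell\subset X$, or $X$ cuts out on $\ell$ a divisor $2a+2b+D'$ with $D'$ effective ($a=b$ allowed). $\mathrm{Bit}(X)\subset G_1(\mathbb{P}^3)$ is the variety of bitangent lines of $X$. The Kummer quartic surface associated with a smooth genus $2$ curve $C$ is the quotient $J(C)/(\iota)$ of the Jacobian by the negation involution, embedded in $\mathbb{P}^3$ as a quartic surface. The curve $C$ is supersingular if $J(C)$ has only one $2$-torsion point. In that case the surface is given in suitable coordinates by $$X_0=V(x^3w+\alpha x^3y+x^2yz+\alpha^2x^2z^2+xy^3+y^2w^2+z^4),\qquad \alpha\in\Bbbk.$$ A trope is a plane cutting the surface along a double conic; here the trope is $V(x)$. *)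

(* Defs.v *)
From HB Require Import structures.
From mathcomp Require Import all_boot all_order all_algebra.
From mathcomp Require Import mpoly.

Set Implicit Arguments.
Unset Strict Implicit.
Unset Printing Implicit Defensive.

Import GRing.Theory.
Local Open Scope ring_scope.

(* Linear subspaces of P^3 are vector subspaces of k^4 (row vectors): points,
   lines and planes have vector-space dimension 1, 2 and 3.  A set of lines is
   a predicate on {vspace 'rV[k]_4} that holds only for lines. *)

Section Forms.
Variable k : closedFieldType.

Definition evalv n (F : {mpoly k[n]}) (v : 'rV[k]_n) : k :=
  F.@[fun i => v 0 i].

(* F(t_0 b_0 + ... + t_(m-1) b_(m-1)) as a form in t_0, ..., t_(m-1). *)
Definition restrict n m (F : {mpoly k[n]}) (b : m.-tuple 'rV[k]_n)
    : {mpoly k[m]} :=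
  F \mPo [tuple \sum_(i < m) (tnth b i) 0 j *: 'X_i | j < n].

Definition hyperplane n (u : 'rV[k]_n) : {vspace 'rV[k]_n} :=
  lker (linfun (mulmxr u^T : 'rV[k]_n -> 'rV[k]_1)).

(* The value of the form at the point itself is part of the condition: in
   characteristic 2, Euler's formula does not recover it from the partials. *)
Definition smooth_conic (q : {mpoly k[3]}) : Prop :=
  q \is 2%N.-homog /\
  forall v : 'rV[k]_3, v != 0 ->
    ~ (evalv q v = 0 /\ forall i : 'I_3, evalv q^`M(i) v = 0).

(* Cone over a smooth conic in the plane spanned by the rows of E, with vertex
   the point v outside that plane, as a set of points of P^(n-1). *)
Definition quadric_cone n (S : {vspace 'rV[k]_n} -> Prop) : Prop :=
  exists (E : 'M[k]_(3, n)) (v : 'rV[k]_n) (q : {mpoly k[3]}),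
    [/\ row_free (col_mx E v), smooth_conic q
      & forall P, S P <->
          exists (c : 'rV[k]_3) (a : k),
            [/\ evalv q c = 0, c *m E + a *: v != 0
              & P = <[c *m E + a *: v]>%VS]].

End Forms.

Section Congruences.
Variable k : closedFieldType.
Implicit Types (L T : {vspace 'rV[k]_4}) (S : {vspace 'rV[k]_4} -> Prop).

(* p_01, p_02, p_03, p_12, p_13, p_23; the indices 0, 1, 2, 3 are read in
   'I_4, seen as the ring of integers modulo 4. *)
Definition plucker_coords (u v : 'rV[k]_4) : 'rV[k]_6 :=
  \row_(a < 6)
    let ij := tnth [tuple ((0 : 'I_4), (1 : 'I_4)); (0, 2); (0, 3);
                          (1, 2); (1, 3); (2, 3)] a in
    u 0 ij.1 * v 0 ij.2 - u 0 ij.2 * v 0 ij.1.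

Definition plucker L : {vspace 'rV[k]_6} :=
  <[plucker_coords (vbasis L)`_0 (vbasis L)`_1]>%VS.

Definition plucker_image S (P : {vspace 'rV[k]_6}) : Prop :=
  exists2 L, S L & P = plucker L.

Definition beta_plane T L : Prop := \dim L = 2%N /\ (L <= T)%VS.

(* P holds on a nonempty principal open subset of P^3, in homogeneous
   coordinates. *)
Definition for_general (P : 'rV[k]_4 -> Prop) : Prop :=
  exists (d : nat) (h : {mpoly k[4]}),
    [/\ h \is d.-homog, h != 0
      & forall v : 'rV[k]_4, v != 0 -> evalv h v != 0 -> P v].

Definition has_card S (n : nat) : Prop :=
  exists s : seq {vspace 'rV[k]_4},
    [/\ uniq s, size s = n & forall L, L \in s <-> S L].

Definition bidegree S (m n : nat) : Prop :=
  for_general (fun v => has_card (fun L => S L /\ v \in L) m) /\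
  for_general (fun u => has_card (fun L => S L /\ (L <= hyperplane u)%VS) n).

(* The form on P^1 vanishing exactly at the point a. *)
Definition point_form (a : 'rV[k]_2) : {mpoly k[2]} :=
  a 0 1 *: 'X_0 - a 0 0 *: 'X_1.

(* The divisor of zeros of f is the sum of the points of D, listed with
   multiplicity. *)
Definition has_divisor (f : {mpoly k[2]}) (D : seq 'rV[k]_2) : Prop :=
  all (fun a => a != 0) D /\
  exists2 c : k, c != 0 & f = c *: \prod_(a <- D) point_form a.

Definition bitangent (F : {mpoly k[4]}) L : Prop :=
  \dim L = 2%N /\
  ((forall v, v \in L -> evalv F v = 0) \/
   exists2 e : 2.-tuple 'rV[k]_4, basis_of L e &
     exists (a b : 'rV[k]_2) (D' : seq 'rV[k]_2),
       has_divisor (restrict F e) ([:: a; a; b; b] ++ D')).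

Definition trope (F : {mpoly k[4]}) T : Prop :=
  exists2 e : 3.-tuple 'rV[k]_4, \dim T = 3%N /\ basis_of T e &
    exists (c : k) (q : {mpoly k[3]}),
      [/\ c != 0, smooth_conic q & restrict F e = c *: q ^+ 2].

(* For invertible M, the entries of v *m M are the coordinates x, y, z, w of
   the point v in which the Kummer surface has its normal form. *)
Definition coord_form (M : 'M[k]_4) (j : 'I_4) : {mpoly k[4]} :=
  \sum_(i < 4) M i j *: 'X_i.

Definition kummer_supersingular (alpha : k) (M : 'M[k]_4) : {mpoly k[4]} :=
  let x := coord_form M 0 in let y := coord_form M 1 in
  let z := coord_form M 2 in let w := coord_form M 3 in
  x ^+ 3 * w + alpha *: (x ^+ 3 * y) + x ^+ 2 * y * z
  + alpha ^+ 2 *: (x ^+ 2 * z ^+ 2) + x * y ^+ 3 + y ^+ 2 * w ^+ 2 + z ^+ 4.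

(* The plane x = 0. *)
Definition kummer_trope (M : 'M[k]_4) : {vspace 'rV[k]_4} :=
  hyperplane (col 0 M)^T.

End Congruences.

(* Main.v *)
(* A nonzero binary quartic over an algebraically closed field of characteristic
   2 has divisor 2a + 2b iff it is a square, iff its coefficients of s^3 t and
   s t^3 vanish.  For the restriction of the Kummer form to the line through
   r = (x, y, z, w) and r' = (x', y', z', w'), these coefficients are
   x^2 A + y^2 B and x'^2 A + y'^2 B, where A = p03 + p12 + alpha p01 and
   B = p01 are Pluecker coordinates of the line.  Eliminating gives B^3 = 0, so a
   bitangent line either lies in the plane x = 0 or satisfies p01 = 0 and
   p03 = p12.  On the Grassmannian p01 p23 - p02 p13 + p03 p12 = 0 the latter
   conditions cut out the cone p02 p13 = p03^2 with vertex the line x = y = 0. *)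

Require Import Defs.
From HB Require Import structures.
From mathcomp Require Import all_boot all_order all_algebra.
From mathcomp Require Import mpoly ring.

Set Implicit Arguments.
Unset Strict Implicit.
Unset Printing Implicit Defensive.

Import GRing.Theory.
Local Open Scope ring_scope.

(** * Small index sets, squares in characteristic 2, and partial derivatives of variables *)

Lemma sum_ord3 (V : nmodType) (F : 'I_3 -> V) : \sum_(i < 3) F i = F 0 + F 1 + F 2.
Proof.
rewrite !big_ord_recl big_ord0 addr0 !addrA.
by congr (F _ + F _ + F _); apply/val_inj.
Qed.

Lemma forall_ord3 (P : 'I_3 -> Prop) : P 0 -> P 1 -> P 2 -> forall i, P i.
Proof.
move=> h0 h1 h2 i; have : i \in [:: 0; 1; 2] by case: i => [[|[|[|]]]].
by rewrite !inE => /or3P[] /eqP->.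
Qed.

Lemma sum_ord4 (V : nmodType) (F : 'I_4 -> V) :
  \sum_(i < 4) F i = F 0 + F 1 + F 2 + F 3.
Proof.
rewrite !big_ord_recl big_ord0 addr0 !addrA.
by congr (F _ + F _ + F _ + F _); apply/val_inj.
Qed.

Lemma sum_ord6 (V : nmodType) (F : 'I_6 -> V) :
  \sum_(i < 6) F i = F 0 + F 1 + F 2 + F 3 + F 4 + F 5.
Proof.
rewrite !big_ord_recl big_ord0 addr0 !addrA.
by congr (F _ + F _ + F _ + F _ + F _ + F _); apply/val_inj.
Qed.

Lemma forall_ord4 (P : 'I_4 -> Prop) : P 0 -> P 1 -> P 2 -> P 3 -> forall i, P i.
Proof.
move=> h0 h1 h2 h3 i.
have : i \in [:: 0; 1; 2; 3] by case: i => [[|[|[|[|]]]]].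
by rewrite !inE => /or4P[] /eqP->.
Qed.

Lemma forall_ord6 (P : 'I_6 -> Prop) :
  P 0 -> P 1 -> P 2 -> P 3 -> P 4 -> P 5 -> forall i, P i.
Proof.
move=> h0 h1 h2 h3 h4 h5 i.
have : i \in [:: 0; 1; 2; 3; 4; 5] by case: i => [[|[|[|[|[|[|]]]]]]].
by rewrite !inE => /or4P[/eqP->|/eqP->|/eqP->|/or3P[] /eqP->].
Qed.

Lemma sqrrD_pchar2 (R : comNzRingType) : 2%N \in [pchar R] ->
  forall x y : R, (x + y) ^+ 2 = x ^+ 2 + y ^+ 2.
Proof.
by move=> h x y; rewrite sqrrD mulr2n addrr_pchar2 // addr0.
Qed.

Lemma mderivXU (R : nzRingType) n (i j : 'I_n) :
  ('X_j : {mpoly R[n]})^`M(i) = (i == j)%:R.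
Proof.
rewrite mderivX mnm1E eq_sym; case: eqP => [->|_]; last by rewrite scale0r.
rewrite scale1r (_ : (U_(j) - U_(j))%MM = 0%MM) ?mpolyX0 //.
by apply/mnmP => l; rewrite mnmBE subnn mnm0E.
Qed.

(** * Binary quartics in characteristic 2 and their divisors *)

Section BinaryForms.
Variable k : closedFieldType.
Hypothesis hk : 2%N \in [pchar k].

Definition bquartic (c0 c1 c2 c3 c4 : k) : {mpoly k[2]} :=
  c0%:MP * 'X_0 ^+ 4 + c1%:MP * ('X_0 ^+ 3 * 'X_1)
  + c2%:MP * ('X_0 ^+ 2 * 'X_1 ^+ 2) + c3%:MP * ('X_0 * 'X_1 ^+ 3)
  + c4%:MP * 'X_1 ^+ 4.

Lemma pchar2_mpoly n : 2%N \in [pchar {mpoly k[n]}].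
Proof.
by rewrite !inE /= -mpolyC_nat pcharf0 ?mpolyC0.
Qed.

Lemma exists_sqrt (x : k) : exists y, y ^+ 2 = x.
Proof.
have /closed_rootP[y] : size ('X^2 - x%:P) != 1%N.
  by rewrite size_XnsubC.
by rewrite /root !hornerE subr_eq0 => /eqP; exists y.
Qed.

Lemma binary_quadratic_splits (r0 r1 r2 : k) :
  let g : {mpoly k[2]} :=
    r0 *: 'X_0 ^+ 2 + r1 *: ('X_0 * 'X_1) + r2 *: 'X_1 ^+ 2 in
  g != 0 -> exists (c : k) (a b : 'rV[k]_2), [/\ c != 0, a != 0, b != 0
    & g = c *: (point_form a * point_form b)].
Proof.
move=> g g0.
have pf (x y : k) : point_form (\row_(i < 2) if i == 0 then x else y)
    = y *: 'X_0 - x *: 'X_1 by rewrite /point_form !mxE.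
have nz (x y : k) : (x != 0) || (y != 0) ->
    (\row_(i < 2) if i == 0 then x else y) != 0.
  by apply: contraTN => /eqP/rowP e; have:= e 0; have:= e 1;
    rewrite !mxE /= => -> ->; rewrite eqxx.
have [r00|r0n] := eqVneq r0 0.
  (* Here ['X_1] divides the form. The point (1, 0) contributes [- 'X_1], whose sign the constant -1
     cancels. *)
  exists (-1), (\row_(i < 2) if i == 0 then 1 else 0),
    (\row_(i < 2) if i == 0 then - r2 else r1).
  split; rewrite ?oppr_eq0 ?oner_eq0 // ?nz ?oner_eq0 //.
    rewrite oppr_eq0 -negb_and; apply: contraNN g0 => /andP[/eqP e2 /eqP e1].
    by rewrite /g r00 e1 e2 !scale0r !addr0.
  by rewrite !pf /g r00 -!mul_mpolyC; ring.
(* The form divided by [r0], dehomogenised at ['X_1] = 1. If t is a root, the other root is -(r1/r0)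
   - t by Vieta. *)
pose p : {poly k} := Poly [:: r2 / r0; r1 / r0; 1].
have /closed_rootP[t] : size p != 1%N.
  by rewrite (PolyK (c := 0)) ?oner_eq0.
rewrite /root /p horner_Poly /= mul0r add0r mul1r => /eqP et.
exists r0, (\row_(i < 2) if i == 0 then t else 1),
  (\row_(i < 2) if i == 0 then - (r1 / r0) - t else 1).
split=> //; rewrite ?nz ?oner_eq0 ?orbT //.
have e1 : r1 = r0 * (r1 / r0) by rewrite mulrCA divff ?mulr1.
have e2 : r2 = r0 * (- (t + r1 / r0) * t).
  have -> : - (t + r1 / r0) * t = r2 / r0.
    by apply/eqP; rewrite mulNr eq_sym -addr_eq0 addrC; apply/eqP.
  by rewrite mulrCA divff ?mulr1.
rewrite !pf /g; move: (r1 / r0) e1 e2 => u -> ->.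
by rewrite -!mul_mpolyC; ring.
Qed.

Definition vec2 (s t : k) (i : 'I_2) : k := if i == 0 then s else t.

Lemma meval_bquartic c0 c1 c2 c3 c4 s t :
  (bquartic c0 c1 c2 c3 c4).@[vec2 s t] = c0 * s ^+ 4 + c1 * (s ^+ 3 * t)
   + c2 * (s ^+ 2 * t ^+ 2) + c3 * (s * t ^+ 3) + c4 * t ^+ 4.
Proof.
have E (A B : comNzRingType) (f : {rmorphism A -> B}) a0 a1 a2 a3 a4 x y :
    f (a0 * x ^+ 4 + a1 * (x ^+ 3 * y) + a2 * (x ^+ 2 * y ^+ 2)
       + a3 * (x * y ^+ 3) + a4 * y ^+ 4) =
    f a0 * f x ^+ 4 + f a1 * (f x ^+ 3 * f y) + f a2 * (f x ^+ 2 * f y ^+ 2)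
       + f a3 * (f x * f y ^+ 3) + f a4 * f y ^+ 4 by ring.
by rewrite /bquartic (E _ _ (meval (vec2 s t))) /= !mevalC !mevalXU.
Qed.

(** Modulo 2 only the odd powers of ['X_0] survive differentiation, so this derivative isolates the
    two coefficients that obstruct being a square. *)
Lemma mderiv_bquartic c0 c1 c2 c3 c4 :
  (bquartic c0 c1 c2 c3 c4)^`M(0) =
    c1%:MP * ('X_0 ^+ 2 * 'X_1) + c3%:MP * 'X_1 ^+ 3.
Proof.
have p2 := pchar2_mpoly 2.
rewrite /bquartic !exprS expr0 !mulr1 !(mderivD, mderiv_mulC, mderivM, mderivXU) /=.
rewrite !(mul0r, mulr0, mul1r, mulr1, addr0).
have e (x : {mpoly k[2]}) : x + x = 0 by rewrite addrr_pchar2.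
by rewrite !mulrDr !(e, addrA, addr0, add0r, mul0r, mulr0).
Qed.

Lemma mderiv_sqr n (i : 'I_n) (p : {mpoly k[n]}) : (p ^+ 2)^`M(i) = 0.
Proof.
by rewrite expr2 mderivM mulrC addrr_pchar2 // pchar2_mpoly.
Qed.

(** The derivative of a square is zero in characteristic 2; evaluating the derivative of the quartic
    at (0, 1) and (1, 1) then gives both coefficients. *)
Lemma bquartic_sqr_coef c0 c1 c2 c3 c4 c g :
  bquartic c0 c1 c2 c3 c4 = c *: g ^+ 2 -> c1 = 0 /\ c3 = 0.
Proof.
move=> /(congr1 (mderiv 0)); rewrite mderiv_bquartic mderivZ mderiv_sqr scaler0.
have E (A B : comNzRingType) (f : {rmorphism A -> B}) a1 a3 x y :
    f (a1 * (x ^+ 2 * y) + a3 * y ^+ 3) = f a1 * (f x ^+ 2 * f y) + f a3 * f y ^+ 3.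
  by ring.
move=> e.
have ev s t : c1 * (s ^+ 2 * t) + c3 * t ^+ 3 = 0.
  have:= congr1 (meval (vec2 s t)) e.
  by rewrite (E _ _ (meval (vec2 s t))) raddf0 /= !mevalC !mevalXU.
have c30 : c3 = 0 by have:= ev 0 1; rewrite expr0n /= !mul0r expr1n mulr0 add0r mulr1.
by split=> //; have:= ev 1 1; rewrite c30 !expr1n mul0r addr0 !mulr1.
Qed.

Lemma bquartic_eq0_coef c0 c1 c2 c3 c4 :
  (forall s t, (bquartic c0 c1 c2 c3 c4).@[vec2 s t] = 0) -> c1 = 0 /\ c3 = 0.
Proof.
move=> h.
have c00 : c0 = 0.
  by have:= h 1 0; rewrite meval_bquartic; move<-; ring.
have c40 : c4 = 0.
  by have:= h 0 1; rewrite meval_bquartic; move<-; ring.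
(* With [c0] = [c4] = 0, the quartic at (s, 1) equals p(s) - 1. A root of p would give 1 = 0, so p
   has no root and is constant. *)
pose p : {poly k} := Poly [:: 1; c3; c2; c1].
have sp : (size p <= 1)%N.
  rewrite -[(_ <= _)%N]negbK; apply/negP => sp.
  have /closed_rootP[s] : size p != 1%N by rewrite neq_ltn orbC ltnNge sp.
  rewrite /root /p horner_Poly /= => /eqP e.
  have:= h s 1; rewrite meval_bquartic c00 c40 => e'.
  suff /eqP: (1 : k) = 0 by rewrite oner_eq0.
  by have:= congr2 (fun a b => a - b) e e'; rewrite subr0 => <-; ring.
have cp i : (0 < i)%N -> p`_i = 0 by move=> i0; rewrite nth_default // (leq_trans sp).
by have:= cp 1%N isT; have:= cp 3%N isT; rewrite !coef_Poly.
Qed.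

Lemma point_form_neq0 (a : 'rV[k]_2) : a != 0 -> point_form a != 0.
Proof.
apply: contraNN => /eqP e; apply/eqP/rowP => i; rewrite mxE.
have ev s t : a 0 1 * s - a 0 0 * t = 0.
  have:= congr1 (fun f => f.@[vec2 s t]) e.
  by rewrite /point_form mevalB !mevalZ !mevalXU meval0.
have:= ev 1 0; have:= ev 0 1; rewrite !mulr1 !mulr0 subr0 sub0r.
move/eqP; rewrite oppr_eq0 => /eqP a0 a1.
by case: i => [[|[|//]]] Hi; [rewrite -[RHS]a0|rewrite -[RHS]a1];
  congr (a _ _); apply/val_inj.
Qed.

Lemma point_form_homog (a : 'rV[k]_2) : point_form a \is 1%N.-homog.
Proof.
by rewrite /point_form rpredB // dhomogZ // dhomogX /= mdeg1.
Qed.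

Lemma prod_point_form_homog (D : seq 'rV[k]_2) :
  \prod_(a <- D) point_form a \is (size D).-homog.
Proof.
elim: D => [|a D IH]; first by rewrite big_nil dhomog1.
by rewrite big_cons -[size _]/(1 + size D)%N dhomogM ?point_form_homog.
Qed.

Lemma bquartic_homog c0 c1 c2 c3 c4 : bquartic c0 c1 c2 c3 c4 \is 4%N.-homog.
Proof.
have X1 (i : 'I_2) : ('X_i : {mpoly k[2]}) \is 1%N.-homog by rewrite dhomogX /= mdeg1.
have X2 (i : 'I_2) n : ('X_i : {mpoly k[2]}) ^+ n \is n.-homog.
  by rewrite -[n in n.-homog]mul1n dhomogMn.
rewrite /bquartic; do 4?[apply: rpredD]; rewrite mul_mpolyC; apply: dhomogZ.
- exact: X2.
- exact: (dhomogM (X2 _ 3%N) (X1 _)).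
- exact: (dhomogM (X2 _ 2%N) (X2 _ 2%N)).
- exact: (dhomogM (X1 _) (X2 _ 3%N)).
- exact: X2.
Qed.

Lemma prod_point_form_neq0 (D : seq 'rV[k]_2) : all (fun a => a != 0) D ->
  \prod_(a <- D) point_form a != 0.
Proof.
elim: D => [|a D IH] /=; first by rewrite big_nil oner_eq0.
by case/andP=> a0 /IH D0; rewrite big_cons mulf_neq0 ?point_form_neq0.
Qed.

Lemma bquartic_has_divisor c0 c1 c2 c3 c4 (a b : 'rV[k]_2) D :
  has_divisor (bquartic c0 c1 c2 c3 c4) ([:: a; a; b; b] ++ D) ->
  c1 = 0 /\ c3 = 0.
Proof.
case=> D0 [c c0' e].
have nz : bquartic c0 c1 c2 c3 c4 != 0.
  by rewrite e scaler_eq0 negb_or c0' prod_point_form_neq0.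
(* A nonzero form has only one degree, so the four points a, a, b, b already exhaust the divisor and
   the form is a constant times a square. *)
have D4 : 4%N = size ([:: a; a; b; b] ++ D).
  apply: (dhomog_uniq nz (bquartic_homog _ _ _ _ _)).
  by rewrite e dhomogZ // prod_point_form_homog.
have {}D4 : D = [::] by apply/eqP; rewrite -size_eq0; case: D D4 {D0 e}.
apply: (@bquartic_sqr_coef c0 c1 c2 c3 c4 c (point_form a * point_form b)).
by rewrite e D4 /= !big_cons big_nil; congr (_ *: _); ring.
Qed.

(** Squaring is additive, so square roots of the three coefficients give g with f = g^2; the two
    linear factors of g each count twice in f. *)
Lemma bquartic_has_divisorI c0 c2 c4 :
  let f := bquartic c0 0 c2 0 c4 in
  f != 0 -> exists a b : 'rV[k]_2, has_divisor f [:: a; a; b; b].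
Proof.
move=> f f0.
have [r0 e0] := exists_sqrt c0; have [r2 e2] := exists_sqrt c2.
have [r4 e4] := exists_sqrt c4.
pose g : {mpoly k[2]} :=
  r0 *: 'X_0 ^+ 2 + r2 *: ('X_0 * 'X_1) + r4 *: 'X_1 ^+ 2.
have fg : f = g ^+ 2.
  rewrite /g !(sqrrD_pchar2 (pchar2_mpoly 2)) !exprZn e0 e2 e4 /f /bquartic.
  by rewrite -!mul_mpolyC mpolyC0; ring.
have gn : g != 0 by apply: contraNN f0 => /eqP g0; rewrite fg g0 expr0n.
have [c [a [b [cn a0 b0 eg]]]] := binary_quadratic_splits gn.
exists a, b; split; first by rewrite /= a0 b0.
exists (c ^+ 2); rewrite ?expf_neq0 // fg /g eg !big_cons big_nil exprZn.
by congr (_ *: _); ring.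
Qed.

End BinaryForms.

(** * The Kummer form restricted to a line *)

Section Kummer.
Variable k : closedFieldType.
Hypothesis hk : 2%N \in [pchar k].
Implicit Types (u v r s : 'rV[k]_4) (L : {vspace 'rV[k]_4}).

(** The Plücker coordinate p_ij of the line through u and v. *)
Definition minor (i j : 'I_4) u v : k := u 0 i * v 0 j - u 0 j * v 0 i.

Lemma minor_comb i j (a b c d : k) u v :
  minor i j (a *: u + b *: v) (c *: u + d *: v) = (a * d - b * c) * minor i j u v.
Proof. by rewrite /minor !mxE; ring. Qed.

Lemma meval_coord_form (M : 'M[k]_4) j v : evalv (coord_form M j) v = (v *m M) 0 j.
Proof.
rewrite /evalv /coord_form raddf_sum mxE; apply: eq_bigr => i _.
by rewrite /= mevalZ mevalXU mulrC.
Qed.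

Lemma restrict_coord_form m (M : 'M[k]_4) j (e : m.-tuple 'rV[k]_4) :
  restrict (coord_form M j) e = \sum_(i < m) (tnth e i *m M) 0 j *: 'X_i.
Proof.
rewrite /restrict /coord_form raddf_sum /=.
under eq_bigr => i _ do
  rewrite comp_mpolyZ comp_mpolyXU -tnth_nth tnth_mktuple scaler_sumr.
rewrite exchange_big /=; apply: eq_bigr => i _; rewrite mxE scaler_suml.
by apply: eq_bigr => l _; rewrite scalerA mulrC.
Qed.

(** Stated over any commutative ring, to serve both for values in k and for restrictions in
    polynomial rings. *)
Definition kummer_form (R : comNzRingType) (al x y z w : R) : R :=
  x ^+ 3 * w + al * (x ^+ 3 * y) + x ^+ 2 * y * z
  + al ^+ 2 * (x ^+ 2 * z ^+ 2) + x * y ^+ 3 + y ^+ 2 * w ^+ 2 + z ^+ 4.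

Lemma restrict_kummer m al (M : 'M[k]_4) (e : m.-tuple 'rV[k]_4) :
  let c j := \sum_(i < m) ((tnth e i *m M) 0 j)%:MP * 'X_i in
  restrict (kummer_supersingular al M) e = kummer_form al%:MP (c 0) (c 1) (c 2) (c 3).
Proof.
move=> c.
have E j : restrict (coord_form M j) e = c j.
  by rewrite restrict_coord_form; apply: eq_bigr => i _; rewrite mul_mpolyC.
rewrite -!E /restrict /kummer_supersingular /kummer_form.
by rewrite !(comp_mpolyD, comp_mpolyZ, rmorphM, rmorphXn) -!mul_mpolyC rmorphXn.
Qed.

(* [polar] and [polar2] are the coefficients of t_0^3 t_1 and of t_0^2 t_1^2 in
   the Kummer form at t_0 r + t_1 s, with all integer coefficients kept. *)
Definition polar (al : k) r s : k :=
  (3%:R * r 0 0 ^+ 2 * r 0 3 + 3%:R * al * r 0 0 ^+ 2 * r 0 1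
   + 2%:R * r 0 0 * r 0 1 * r 0 2 + 2%:R * al ^+ 2 * r 0 0 * r 0 2 ^+ 2
   + r 0 1 ^+ 3) * s 0 0
  + (al * r 0 0 ^+ 3 + r 0 0 ^+ 2 * r 0 2 + 3%:R * r 0 0 * r 0 1 ^+ 2
     + 2%:R * r 0 1 * r 0 3 ^+ 2) * s 0 1
  + (r 0 0 ^+ 2 * r 0 1 + 2%:R * al ^+ 2 * r 0 0 ^+ 2 * r 0 2
     + 4%:R * r 0 2 ^+ 3) * s 0 2
  + (r 0 0 ^+ 3 + 2%:R * r 0 1 ^+ 2 * r 0 3) * s 0 3.

Definition polar2 (al : k) r s : k :=
  let x := r 0 0 in let y := r 0 1 in let z := r 0 2 in let w := r 0 3 in
  let x' := s 0 0 in let y' := s 0 1 in let z' := s 0 2 in let w' := s 0 3 in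
  3%:R * x * x' * (x' * w + x * w' + al * (x' * y + x * y'))
  + x ^+ 2 * y' * z' + 2%:R * x * x' * (y * z' + y' * z) + x' ^+ 2 * y * z
  + al ^+ 2 * (x ^+ 2 * z' ^+ 2 + 4%:R * x * x' * z * z' + x' ^+ 2 * z ^+ 2)
  + 3%:R * y * y' * (x * y' + x' * y)
  + y ^+ 2 * w' ^+ 2 + 4%:R * y * y' * w * w' + y' ^+ 2 * w ^+ 2
  + 6%:R * z ^+ 2 * z' ^+ 2.

(** A formal expansion valid in every characteristic, hence in reach of [ring]. By symmetry the
    coefficient of t_0 t_1^3 is [polar] with r and s exchanged. *)
Lemma kummer_form_line al r s :
  let c j : {mpoly k[2]} := (r 0 j)%:MP * 'X_0 + (s 0 j)%:MP * 'X_1 in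
  kummer_form al%:MP (c 0) (c 1) (c 2) (c 3) =
  bquartic (kummer_form al (r 0 0) (r 0 1) (r 0 2) (r 0 3)) (polar al r s)
   (polar2 al r s) (polar al s r) (kummer_form al (s 0 0) (s 0 1) (s 0 2) (s 0 3)).
Proof.
move=> c; rewrite {}/c /bquartic /kummer_form /polar /polar2.
move: (r 0 0) (r 0 1) (r 0 2) (r 0 3) (s 0 0) (s 0 1) (s 0 2) (s 0 3).
move=> x y z w x' y' z' w'.
ring.
Qed.

(** Reduction modulo 2 turns the polar into an expression in the Plücker coordinates p01, p03, p12
    and the squares of two coordinates of r. *)
Lemma polarE al r s : polar al r s =
  r 0 0 ^+ 2 * (minor 0 3 r s + minor 1 2 r s + al * minor 0 1 r s)
  + r 0 1 ^+ 2 * minor 0 1 r s.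
Proof.
rewrite /polar /minor; move: (r 0 0) (r 0 1) (r 0 2) (r 0 3).
move=> x y z w.
move: (s 0 0) (s 0 1) (s 0 2) (s 0 3) => x' y' z' w'.
apply/eqP; rewrite -subr_eq0; apply/eqP.
(* The factor after 2 is half the difference of the two sides, computed with integer
   coefficients. *)
transitivity (2%:R *
  ((2%:R * x ^+ 2 * w + 2%:R * al * x ^+ 2 * y + x * y * z + al ^+ 2 * x * z ^+ 2
    + y ^+ 3) * x' + (x ^+ 2 * z + x * y ^+ 2 + y * w ^+ 2) * y'
    + (al ^+ 2 * x ^+ 2 * z + 2%:R * z ^+ 3) * z' + y ^+ 2 * w * w')).
  by ring.
by rewrite pcharf0 // mul0r.
Qed.

End Kummer.

(** * Lines of projective space through bases of two vectors *)

Section Lines.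
Variable k : closedFieldType.
Implicit Types (u v r s : 'rV[k]_4) (L : {vspace 'rV[k]_4}).

Lemma exists_basis2 L : \dim L = 2%N -> exists e : 2.-tuple 'rV[k]_4, basis_of L e.
Proof.
move=> dL; suff : exists e : (\dim L).-tuple 'rV[k]_4, basis_of L e by rewrite dL.
by exists (vbasis L); exact: vbasisP.
Qed.

Lemma tuple2E (T : Type) (e : 2.-tuple T) : tval e = [:: tnth e 0; tnth e 1].
Proof. by case: e => [[|x [|y []]]]. Qed.

Lemma mem_basis2 L (e : 2.-tuple 'rV[k]_4) : basis_of L e ->
  forall v, v \in L <-> exists a b, v = a *: tnth e 0 + b *: tnth e 1.
Proof.
case/andP=> /eqP <- _ v; rewrite (tuple2E e).
rewrite span_cons span_seq1; split.
  by case/memv_addP => _ /vlineP[a ->] [_ /vlineP[b ->] ->]; exists a, b.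
by case=> a [b ->]; rewrite memv_add // memvZ ?memv_line.
Qed.

Lemma meval_restrict_line (F : {mpoly k[4]}) (e : 2.-tuple 'rV[k]_4) a b :
  (restrict F e).@[vec2 a b] = evalv F (a *: tnth e 0 + b *: tnth e 1).
Proof.
rewrite /restrict comp_mpoly_meval; apply: meval_eq => j.
rewrite tnth_mktuple raddf_sum big_ord_recl big_ord1 !mxE /=.
by rewrite !mevalZ !mevalXU /= mulrC [b * _]mulrC; congr (_ * _ + _ * _);
  congr (fun_of_matrix (tnth e _) _ _); apply/val_inj.
Qed.

End Lines.

(** * Bitangent lines are the lines of the trope plane and those of the cone *)

Section Bitangents.
Variable k : closedFieldType.
Hypothesis hk : 2%N \in [pchar k].
Variables (al : k) (M : 'M[k]_4).
Implicit Types (u v r s : 'rV[k]_4) (L : {vspace 'rV[k]_4}).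

Lemma restrict_kummer_line (e : 2.-tuple 'rV[k]_4) :
  let r := tnth e 0 *m M in let s := tnth e 1 *m M in
  restrict (kummer_supersingular al M) e =
  bquartic (kummer_form al (r 0 0) (r 0 1) (r 0 2) (r 0 3)) (polar al r s)
   (polar2 al r s) (polar al s r) (kummer_form al (s 0 0) (s 0 1) (s 0 2) (s 0 3)).
Proof.
move=> r s; rewrite restrict_kummer -kummer_form_line.
have E j : \sum_(i < 2) ((tnth e i *m M) 0 j)%:MP * 'X_i
    = (r 0 j)%:MP * 'X_0 + (s 0 j)%:MP * 'X_1 :> {mpoly k[2]}.
  rewrite big_ord_recl big_ord1.
  by rewrite (_ : lift _ _ = 1) //; apply/val_inj.
by rewrite !E.
Qed.

(** In [polarE] the minors scale by the determinant and the squares are additive. Hence vanishing of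
    both polars on one basis gives vanishing on all pairs of vectors of the line. *)
Lemma polar_comb (a b c d : k) r s :
  polar al (a *: r + b *: s) (c *: r + d *: s) =
  (a * d - b * c) * (a ^+ 2 * polar al r s + b ^+ 2 * polar al s r).
Proof.
have sq x y : (x + y) ^+ 2 = x ^+ 2 + y ^+ 2 :> k by apply: sqrrD_pchar2.
have minorC i j x y : minor i j x y = minor i j y x :> k.
  by rewrite /minor addrC -(oppr_pchar2 hk (_ * _)) opprK mulrC
    -[X in _ + X](oppr_pchar2 hk) [X in _ - X]mulrC.
rewrite !(polarE hk) !minor_comb (minorC _ _ s r).
rewrite (minorC 1 2 s r) (minorC 0 1 s r) !mxE !sq; ring.
Qed.

(** This frees bitangency from the choice of a basis: the polars are the two odd coefficients of the
    restricted quartic, which vanish exactly when it is a square. *)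
Lemma bitangent_polar L :
  bitangent (kummer_supersingular al M) L <->
  \dim L = 2%N /\ {in L &, forall u v, polar al (u *m M) (v *m M) = 0}.
Proof.
set F := kummer_supersingular al M; split=> [[dL h]|[dL h]]; split=> //.
  have [e be [p1 p2]] : exists2 e : 2.-tuple 'rV[k]_4, basis_of L e &
      polar al (tnth e 0 *m M) (tnth e 1 *m M) = 0 /\
      polar al (tnth e 1 *m M) (tnth e 0 *m M) = 0.
    case: h => [h|[e be [a [b [D h]]]]].
      have [e be] := exists_basis2 dL; exists e => //.
      have : forall s t : k, (restrict F e).@[vec2 s t] = 0.
        move=> s t; rewrite meval_restrict_line h //.
        by apply/(mem_basis2 be); exists s, t.
      by rewrite /F restrict_kummer_line => /bquartic_eq0_coef.
    exists e => //; move: h; rewrite /F restrict_kummer_line.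
    exact: bquartic_has_divisor.
  move=> _ _ /(mem_basis2 be)[a [b ->]] /(mem_basis2 be)[c [d ->]].
  by rewrite !mulmxDl -!scalemxAl polar_comb p1 p2 !mulr0 addr0 mulr0.
have [e be] := exists_basis2 dL.
have eL i : tnth e i \in L by rewrite (basis_mem be) ?mem_tnth.
(* A zero restriction has no divisor; it is the case of a line inside the surface. *)
have [f0|fn] := eqVneq (restrict F e) 0.
  left=> _ /(mem_basis2 be)[s [t ->]].
  by rewrite -meval_restrict_line f0 meval0.
right; exists e => //.
move: fn; rewrite /F restrict_kummer_line !h // => /(bquartic_has_divisorI hk)[a [b ab]].
by exists a, b, [::].
Qed.

(** The conditions p01 = 0 and p03 = p12 in the coordinates given by [M], the sum being the
    difference in characteristic 2. Asking them of all pairs avoids choosing a basis. *)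
Definition on_cone L := \dim L = 2%N /\ {in L &, forall u v,
  minor 0 1 (u *m M) (v *m M) = 0 /\
  minor 0 3 (u *m M) (v *m M) + minor 1 2 (u *m M) (v *m M) = 0}.

Lemma on_cone_basis L (e : 2.-tuple 'rV[k]_4) : basis_of L e ->
  minor 0 1 (tnth e 0 *m M) (tnth e 1 *m M) = 0 ->
  minor 0 3 (tnth e 0 *m M) (tnth e 1 *m M)
    + minor 1 2 (tnth e 0 *m M) (tnth e 1 *m M) = 0 -> on_cone L.
Proof.
move=> be m01 m0312; split; first exact: vector.size_basis be.
move=> _ _ /(mem_basis2 be)[a [b ->]] /(mem_basis2 be)[c [d ->]].
by rewrite !mulmxDl -!scalemxAl !minor_comb -mulrDr m01 m0312 !mulr0.
Qed.

Lemma mem_kummer_trope v : (v \in kummer_trope M) = ((v *m M) 0 0 == 0).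
Proof.
rewrite /kummer_trope /hyperplane memv_ker lfunE /= trmxK.
rewrite colE mulmxA -colE; apply/eqP/eqP => [/rowP/(_ 0)|e]; first by rewrite !mxE.
by apply/rowP=> j; rewrite !ord1 mxE e mxE.
Qed.

Lemma bitangentE L :
  bitangent (kummer_supersingular al M) L <->
  beta_plane (kummer_trope M) L \/ on_cone L.
Proof.
rewrite bitangent_polar; split=> [[dL h]|[[dL /subvP h]|[dL h]]]; last 2 first.
- split=> // u v /h; rewrite mem_kummer_trope => /eqP u0 /h.
  rewrite mem_kummer_trope => /eqP v0.
  by rewrite (polarE hk) u0 /minor u0 v0; ring.
- split=> // u v uL vL; rewrite (polarE hk).
  by have [-> ->] := h u v uL vL; ring.
have [e be] := exists_basis2 dL.
have eL i : tnth e i \in L by rewrite (basis_mem be) ?mem_tnth.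
set r := tnth e 0 *m M; set s := tnth e 1 *m M.
have := h _ _ (eL 0) (eL 1); have := h _ _ (eL 1) (eL 0).
rewrite -/r -/s !(polarE hk) => p2 p1.
set A := minor 0 3 r s + minor 1 2 r s + al * minor 0 1 r s in p1.
have {}p2 : s 0 0 ^+ 2 * A + s 0 1 ^+ 2 * minor 0 1 r s = 0.
  by apply/eqP; rewrite -oppr_eq0 -p2; apply/eqP; rewrite /A /minor; ring.
have B0 : minor 0 1 r s = 0.
  apply/eqP; rewrite -[_ == _]andTb -(expf_eq0 _ 3); apply/eqP.
  (* Cancelling A between [p1] and [p2] leaves (x^2 y'^2 - x'^2 y^2) B, with B = p01 = x y' - x' y.
     This differs from B^3 by a multiple of 2, which is the last term. *)
  transitivity (r 0 0 ^+ 2 * 0 - s 0 0 ^+ 2 * 0 + 2%:R *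
      ((r 0 1 ^+ 2 * s 0 0 ^+ 2 - r 0 0 * r 0 1 * s 0 0 * s 0 1) * minor 0 1 r s)).
    by rewrite -{1}p2 -p1 /minor; ring.
  by rewrite pcharf0 //; ring.
(* With B = 0 the relations read x^2 A = x'^2 A = 0: either A = 0, which is the cone, or x = x' = 0,
   which is the trope plane. *)
have [A0|An] := eqVneq A 0.
  by right; apply: (on_cone_basis be); move: A0; rewrite /A B0 mulr0 addr0.
have x0 (x y : k) : x ^+ 2 * A + y ^+ 2 * minor 0 1 r s = 0 -> x = 0.
  by rewrite B0 mulr0 addr0 => /eqP; rewrite mulf_eq0 (negPf An) orbF expf_eq0
    => /eqP.
left; split=> //; apply/subvP => _ /(mem_basis2 be)[a [b ->]].
rewrite mem_kummer_trope mulmxDl -!scalemxAl -/r -/s.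
rewrite mxE [X in X + _]mxE [X in _ + X]mxE.
by rewrite (x0 _ _ p1) (x0 _ _ p2) !mulr0 addr0.
Qed.

End Bitangents.

(** * Plücker coordinates, their behaviour under linear maps, and the quadric cone *)

Section Plucker.
Variable k : closedFieldType.
Implicit Types (u v r s : 'rV[k]_4) (L : {vspace 'rV[k]_4}).

Lemma plucker_coordsE u v :
  (plucker_coords u v 0 0 = minor 0 1 u v) * (plucker_coords u v 0 1 = minor 0 2 u v)
  * (plucker_coords u v 0 2 = minor 0 3 u v) * (plucker_coords u v 0 3 = minor 1 2 u v)
  * (plucker_coords u v 0 4 = minor 1 3 u v) * (plucker_coords u v 0 5 = minor 2 3 u v).
Proof. by do !split; rewrite mxE. Qed.

Lemma plucker_coordsP u v (p : 'rV[k]_6) :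
  [/\ minor 0 1 u v = p 0 0, minor 0 2 u v = p 0 1 & minor 0 3 u v = p 0 2] ->
  [/\ minor 1 2 u v = p 0 3, minor 1 3 u v = p 0 4 & minor 2 3 u v = p 0 5] ->
  plucker_coords u v = p.
Proof.
by move=> [? ? ?] [? ? ?]; apply/rowP; apply: forall_ord6; rewrite plucker_coordsE.
Qed.

Lemma plucker_coords_comb (a b c d : k) u v :
  plucker_coords (a *: u + b *: v) (c *: u + d *: v) =
  (a * d - b * c) *: plucker_coords u v.
Proof.
by apply: plucker_coordsP; rewrite !mxE !minor_comb; split.
Qed.

(** The second compound matrix: the action of [N] on the exterior square, rows ordered as in
    [plucker_coords]. *)
Definition compound (N : 'M[k]_4) : 'M[k]_6 :=
  \matrix_a plucker_coords
    (row (tnth [tuple (0 : 'I_4); 0; 0; 1; 1; 2] a) N)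
    (row (tnth [tuple (1 : 'I_4); 2; 3; 2; 3; 3] a) N).

(** The Cauchy-Binet formula for 2 by 2 minors. *)
Lemma minor_mulmx i j u v (N : 'M[k]_4) :
  minor i j (u *m N) (v *m N) =
  minor 0 1 u v * minor i j (row 0 N) (row 1 N)
  + minor 0 2 u v * minor i j (row 0 N) (row 2 N)
  + minor 0 3 u v * minor i j (row 0 N) (row 3 N)
  + minor 1 2 u v * minor i j (row 1 N) (row 2 N)
  + minor 1 3 u v * minor i j (row 1 N) (row 3 N)
  + minor 2 3 u v * minor i j (row 2 N) (row 3 N).
Proof.
by rewrite /minor !mxE !sum_ord4; ring.
Qed.

Lemma plucker_coords_mulmx u v (N : 'M[k]_4) :
  plucker_coords (u *m N) (v *m N) = plucker_coords u v *m compound N.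
Proof.
have E b : (plucker_coords u v *m compound N) 0 b =
   minor 0 1 u v * plucker_coords (row 0 N) (row 1 N) 0 b
  + minor 0 2 u v * plucker_coords (row 0 N) (row 2 N) 0 b
  + minor 0 3 u v * plucker_coords (row 0 N) (row 3 N) 0 b
  + minor 1 2 u v * plucker_coords (row 1 N) (row 2 N) 0 b
  + minor 1 3 u v * plucker_coords (row 1 N) (row 3 N) 0 b
  + minor 2 3 u v * plucker_coords (row 2 N) (row 3 N) 0 b.
  rewrite mxE sum_ord6 !plucker_coordsE.
  by do !congr (_ + _); congr (_ * _); rewrite mxE.
by apply/rowP; apply: forall_ord6; rewrite E !plucker_coordsE minor_mulmx.
Qed.

Lemma compound_mulmx (A B : 'M[k]_4) : compound (A *m B) = compound A *m compound B.
Proof.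
by apply/row_matrixP => a; rewrite row_mul !rowK !row_mul plucker_coords_mulmx.
Qed.

Lemma compound1 : compound 1%:M = 1%:M.
Proof.
apply/row_matrixP; apply: forall_ord6; rewrite rowK !row1;
  apply: plucker_coordsP; rewrite /minor !mxE;
  by split; rewrite ?(mulr0, mul0r, mulr1, subr0).
Qed.

Lemma compoundK (A B : 'M[k]_4) : A *m B = 1%:M -> compound A *m compound B = 1%:M.
Proof. by rewrite -compound_mulmx -compound1 => ->. Qed.

Lemma minorC i j u v : minor i j u v = - minor j i u v.
Proof. by rewrite /minor; ring. Qed.

Lemma minor_eq0 i j u v : plucker_coords u v = 0 -> minor i j u v = 0.
Proof.
move=> /rowP p0.
have := (p0 0, p0 1, p0 2, p0 3, p0 4, p0 5); rewrite !plucker_coordsE !mxE.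
move=> [[[[[e01 e02] e03] e12] e13] e23].
have diag l : minor l l u v = 0 by rewrite /minor mulrC subrr.
by move: i j; do 2!apply: forall_ord4; do ?[by [] | rewrite minorC
  ?(e01, e02, e03, e12, e13, e23) oppr0].
Qed.

Lemma basis2_neq0 L (e : 2.-tuple 'rV[k]_4) :
  basis_of L e -> plucker_coords (tnth e 0) (tnth e 1) != 0.
Proof.
move/basis_free; rewrite (tuple2E e).
set u := tnth e 0; set v := tnth e 1.
rewrite free_cons seq1_free span_seq1 => /andP[/vlineP uv v0].
apply/eqP => p0; apply: uv.
have /rV0Pn[j vj] := v0.
exists (u 0 j / v 0 j); apply/rowP => i; rewrite mxE.
have /eqP := minor_eq0 i j p0; rewrite /minor subr_eq0 => /eqP e1.
by rewrite mulrAC -e1 mulfK.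
Qed.

Lemma basis2_span u v : plucker_coords u v != 0 ->
  \dim <<[:: u; v]>> = 2%N /\ basis_of <<[:: u; v]>> [tuple u; v].
Proof.
move=> p0; suff f : free [:: u; v].
  by split; [rewrite (eqP f) | rewrite /basis_of eqxx].
rewrite free_cons seq1_free span_seq1; apply/andP; split; apply: contra_neqN p0.
  case/vlineP=> a ->.
  by apply: plucker_coordsP; rewrite !mxE /minor !mxE; split; ring.
by move/eqP->; apply: plucker_coordsP; rewrite !mxE /minor !mxE; split; ring.
Qed.

Lemma vline_eqZ (V : vectType k) (a : k) (x : V) : a != 0 -> (<[a *: x]> = <[x]>)%VS.
Proof.
move=> a0; apply: subv_anti; rewrite -!memvE; apply/andP; split.
  by rewrite memvZ ?memv_line.
by rewrite -[X in X \in _](scalerK a0) memvZ ?memv_line.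
Qed.

Lemma vbasis2 L : \dim L = 2%N -> exists2 e : 2.-tuple 'rV[k]_4, basis_of L e &
  plucker L = <[plucker_coords (tnth e 0%R) (tnth e 1%R)]>%VS.
Proof.
move=> dL; exists (tcast dL (vbasis L)).
  by rewrite /= val_tcast vbasisP.
by rewrite /plucker !(tnth_nth 0) !val_tcast.
Qed.

(** A change of basis multiplies the coordinates by its determinant, so the point does not depend on
    the basis picked by [vbasis]. *)
Lemma plucker_basis L (e : 2.-tuple 'rV[k]_4) : \dim L = 2%N -> basis_of L e ->
  plucker L = <[plucker_coords (tnth e 0%R) (tnth e 1%R)]>%VS.
Proof.
move=> dL be; have [f bf ->] := vbasis2 dL.
have := basis2_neq0 bf.
have /(mem_basis2 be)[a [b ->]] : tnth f 0 \in L.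
  by rewrite (basis_mem bf) ?mem_tnth.
have /(mem_basis2 be)[c [d ->]] : tnth f 1 \in L.
  by rewrite (basis_mem bf) ?mem_tnth.
rewrite plucker_coords_comb => n0; rewrite vline_eqZ //.
by apply: contraNneq n0 => ->; rewrite scale0r.
Qed.

Definition conic : {mpoly k[3]} := 'X_0 * 'X_2 - 'X_1 ^+ 2.

Lemma evalv_conic (c : 'rV[k]_3) : evalv conic c = c 0 0 * c 0 2 - c 0 1 ^+ 2.
Proof. by rewrite /evalv /conic mevalB expr2 !mevalM !mevalXU expr2. Qed.

(** The partials in ['X_0] and ['X_2] leave only the point (0 : 1 : 0). In characteristic 2 all
    partials vanish there, and it is the value of the form that excludes it. *)
Lemma smooth_conic_conic : smooth_conic conic.
Proof.
have X1 (i : 'I_3) : ('X_i : {mpoly k[3]}) \is 1%N.-homog by rewrite dhomogX /= mdeg1.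
split; first by rewrite /conic expr2 rpredB // (@dhomogM _ _ mdeg 1 _ 1).
move=> v v0 [e0 e]; case/negP: v0; apply/eqP/rowP.
have := e 0; have := e 2.
rewrite /evalv /conic expr2 !mderivB !mderivM !mderivXU /=.
rewrite !(mul0r, mulr0, mul1r, mulr1, addr0, add0r, subr0) !mevalXU => v0 v2.
move: e0; rewrite evalv_conic v0 mul0r sub0r => /eqP.
rewrite oppr_eq0 expf_eq0 /= => /eqP v1.
by apply: forall_ord3; rewrite mxE.
Qed.

Definition rv4 (x y z w : k) : 'rV[k]_4 := \row_j [:: x; y; z; w]`_j.

Lemma rv4E x y z w : (rv4 x y z w 0 0 = x) * (rv4 x y z w 0 1 = y)
  * (rv4 x y z w 0 2 = z) * (rv4 x y z w 0 3 = w).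
Proof. by do !split; rewrite mxE. Qed.

(** The vectors with p01 = 0 and p03 = p12: c holds p02, p03, p13, the variables of [conic], and a
    is p23, the coordinate along the vertex. *)
Definition cone_vec (c : 'rV[k]_3) (a : k) : 'rV[k]_6 :=
  \row_j [:: 0; c 0 0; c 0 1; c 0 1; c 0 2; a]`_j.

Lemma cone_vecE c a : (cone_vec c a 0 0 = 0) * (cone_vec c a 0 1 = c 0 0)
  * (cone_vec c a 0 2 = c 0 1) * (cone_vec c a 0 3 = c 0 1)
  * (cone_vec c a 0 4 = c 0 2) * (cone_vec c a 0 5 = a).
Proof. by do !split; rewrite mxE. Qed.

Lemma cone_vec_lin c a :
  c *m \matrix_i cone_vec (delta_mx 0 i) 0 + a *: cone_vec 0 1 = cone_vec c a.
Proof.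
have E b : (c *m \matrix_i cone_vec (delta_mx 0 i) 0) 0 b =
    \sum_i c 0 i * cone_vec (delta_mx 0 i) 0 0 b.
  by rewrite mxE; apply: eq_bigr => i _; rewrite [in RHS]mxE mxE mxE.
have S (x : 'I_3 -> k) j : \sum_i x i * (delta_mx 0 i : 'rV[k]_3) 0 j = x j.
  rewrite (bigD1 j) //= mxE !eqxx mulr1 big1 ?addr0 // => i ij.
  by rewrite mxE eqxx [j == i]eq_sym (negPf ij) mulr0.
have Z : \sum_(i < 3) c 0 i * 0 = 0 by apply: big1 => i _; rewrite mulr0.
apply/rowP; apply: forall_ord6; rewrite mxE E [X in _ + X]mxE;
  under eq_bigr do rewrite cone_vecE; rewrite ?S ?Z !cone_vecE ?mxE; ring.
Qed.

(** On the cone the Plücker relation holds, so every such vector comes from a line. The cases are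
    p02 nonzero, then p13 nonzero, then the vertex. *)
Lemma cone_vec_line c a : evalv conic c = 0 ->
  exists u v, exists2 l, l != 0 & plucker_coords u v = l *: cone_vec c a.
Proof.
rewrite evalv_conic => /eqP; rewrite subr_eq0 => /eqP e.
have [c0|c0] := eqVneq (c 0 0) 0; last first.
  (* The points where the line meets z = 0 and x = 0; their minors are the wanted coordinates times
     p02, using p02 p13 = p03^2. *)
  exists (rv4 (c 0 0) (c 0 1) 0 (- a)), (rv4 0 0 (c 0 0) (c 0 1)), (c 0 0) => //.
  by apply: plucker_coordsP; split; rewrite /minor !rv4E mxE cone_vecE ?e; ring.
have c1 : c 0 1 = 0.
  by apply/eqP; move/eqP: e; rewrite c0 mul0r eq_sym expf_eq0.
have [c2|c2] := eqVneq (c 0 2) 0; last first.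
  exists (rv4 0 (c 0 2) a 0), (rv4 0 0 0 (c 0 2)), (c 0 2) => //.
  by apply: plucker_coordsP; split;
    rewrite /minor !rv4E mxE cone_vecE ?c0 ?c1; ring.
exists (rv4 0 0 1 0), (rv4 0 0 0 a), 1; first by rewrite oner_eq0.
by apply: plucker_coordsP; split;
  rewrite /minor !rv4E mxE cone_vecE ?c0 ?c1 ?c2; ring.
Qed.

Hypothesis hk : 2%N \in [pchar k].

Lemma quadric_cone_on_cone (M : 'M[k]_4) : M \in unitmx ->
  quadric_cone (plucker_image (on_cone M)).
Proof.
move=> hM; set C := compound (invmx M).
have CK : C *m compound M = 1%:M by rewrite compoundK ?mulVmx.
(* The cone is standard in the coordinates given by [M]; [C] carries it back to the original Plücker
   coordinates. *)
exists (\matrix_i cone_vec (delta_mx 0 i) 0 *m C), (cone_vec 0 1 *m C), conic.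
have lin c a : c *m (\matrix_i cone_vec (delta_mx 0 i) 0 *m C)
    + a *: (cone_vec 0 1 *m C) = cone_vec c a *m C.
  by rewrite mulmxA scalemxAl -mulmxDl cone_vec_lin.
split; first 2 last.
- move=> P; split=> [[L [dL h] ->]|[c [a [qc]]]]; last first.
    rewrite lin => n0 ->.
    have [u [v [l l0 uv]]] := cone_vec_line a qc.
    have p : plucker_coords (u *m invmx M) (v *m invmx M) = l *: (cone_vec c a *m C).
      by rewrite plucker_coords_mulmx uv scalemxAl.
    have [|dL be] := @basis2_span (u *m invmx M) (v *m invmx M).
      by rewrite p scaler_eq0 negb_or l0.
    exists <<[:: u *m invmx M; v *m invmx M]>>%VS; last first.
      by rewrite (plucker_basis dL be) p vline_eqZ.
    apply: (on_cone_basis be); rewrite !mulmxKV // -!plucker_coordsE uv.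
      by rewrite mxE cone_vecE mulr0.
    by rewrite mxE [X in _ + X]mxE !cone_vecE addrr_pchar2.
  have [e be ->] := vbasis2 dL; have n0 := basis2_neq0 be.
  have eL i : tnth e i \in L by rewrite (basis_mem be) ?mem_tnth.
  have [m01 /eqP] := h _ _ (eL 0) (eL 1).
  rewrite addr_eq0 oppr_pchar2 // => /eqP m0312.
  set r := tnth e 0 *m M in m01 m0312; set s := tnth e 1 *m M in m01 m0312.
  pose c : 'rV[k]_3 := \row_j [:: minor 0 2 r s; minor 0 3 r s; minor 1 3 r s]`_j.
  have rs : plucker_coords r s = cone_vec c (minor 2 3 r s).
    by apply: plucker_coordsP; rewrite !cone_vecE !mxE.
  have p : plucker_coords (tnth e 0) (tnth e 1) = cone_vec c (minor 2 3 r s) *m C.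
    by rewrite -rs -plucker_coords_mulmx !mulmxK.
  exists c, (minor 2 3 r s); rewrite lin -p; split=> //.
  rewrite evalv_conic !mxE /= expr2 {2}m0312.
  (* The Plücker relation: with p12 = p03, the conic takes the value p01 p23, which is zero as p01 =
     0. *)
  have -> : minor 0 2 r s * minor 1 3 r s - minor 0 3 r s * minor 1 2 r s
    = minor 0 1 r s * minor 2 3 r s by rewrite /minor; ring.
  by rewrite m01 mul0r.
- apply: inj_row_free => x; rewrite -[x]hsubmxK mul_row_col.
  move: (lsubmx x) (rsubmx x) => c a.
  rewrite [a]mx11_scalar mul_scalar_mx lin => /(congr1 (mulmx^~ (compound M))).
  rewrite mul0mx -mulmxA CK mulmx1 => /rowP e0.
  have e j : cone_vec c (a 0 0) 0 j = 0 by rewrite e0 mxE.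
  have := e 1; have := e 2; have := e 4; have := e 5.
  rewrite !cone_vecE => -> c2 c1 c0.
  have -> : c = 0.
    by apply/rowP; apply: forall_ord3; rewrite mxE.
  by rewrite raddf0 row_mx0.
- exact: smooth_conic_conic.
Qed.

End Plucker.

(** * Points, planes and cone lines in the coordinates x, y, z, w *)

Section Congruence.
Variables (k : closedFieldType) (M : 'M[k]_4).
Hypothesis hM : M \in unitmx.
Implicit Types (u v p q : 'rV[k]_4) (L : {vspace 'rV[k]_4}).

Definition crd u j : k := (u *m M) 0 j.
Definition pt x y z w : 'rV[k]_4 := rv4 x y z w *m invmx M.

Lemma minorM i j u v :
  minor i j (u *m M) (v *m M) = crd u i * crd v j - crd u j * crd v i.
Proof. by []. Qed.

Lemma crdD u v j : crd (u + v) j = crd u j + crd v j.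
Proof. by rewrite /crd mulmxDl mxE. Qed.

Lemma crdZ a u j : crd (a *: u) j = a * crd u j.
Proof. by rewrite /crd -scalemxAl mxE. Qed.

Lemma pt_mulmx x y z w : pt x y z w *m M = rv4 x y z w.
Proof. exact: mulmxKV. Qed.

Lemma crd_pt x y z w : (crd (pt x y z w) 0 = x) * (crd (pt x y z w) 1 = y)
  * (crd (pt x y z w) 2 = z) * (crd (pt x y z w) 3 = w).
Proof. by rewrite /crd pt_mulmx !rv4E. Qed.

Lemma crd_inj u v : crd u 0 = crd v 0 -> crd u 1 = crd v 1 ->
  crd u 2 = crd v 2 -> crd u 3 = crd v 3 -> u = v.
Proof.
move=> e0 e1 e2 e3; apply: (can_inj (mulmxK hM)).
by apply/rowP; apply: forall_ord4.
Qed.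

Lemma crd0 j : crd 0 j = 0.
Proof. by rewrite /crd mul0mx mxE. Qed.

Lemma trope_crd v : (v \in kummer_trope M) = (crd v 0 == 0).
Proof. exact: mem_kummer_trope. Qed.

(** Plane coefficients transform by the inverse transpose; d lists them in the coordinates x, y, z,
    w. *)
Lemma mem_hyperplane_crd h v : (v \in hyperplane h) =
  (let d j := (h *m (invmx M)^T) 0 j in
   crd v 0 * d 0 + crd v 1 * d 1 + crd v 2 * d 2 + crd v 3 * d 3 == 0).
Proof.
rewrite /hyperplane memv_ker lfunE /=.
rewrite -(sum_ord4 (fun j => crd v j * (h *m (invmx M)^T) 0 j)).
have E : v *m h^T = (v *m M) *m (h *m (invmx M)^T)^T.
  by rewrite trmx_mul trmxK mulmxA mulmxK.
have -> : \sum_i crd v i * (h *m (invmx M)^T) 0 i = (v *m h^T) 0 0.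
  by rewrite E mxE; apply: eq_bigr => i _; congr (_ * _); rewrite [RHS]mxE.
by apply/eqP/eqP => [->|e]; [rewrite mxE | apply/rowP => j; rewrite !ord1 e mxE].
Qed.

(** A single coordinate after an invertible change is a nonzero linear form. It serves for points
    with [M] and for planes with the inverse transpose. *)
Lemma coord_form_general (N : 'M[k]_4) j (P : 'rV[k]_4 -> Prop) : N \in unitmx ->
  (forall v, (v *m N) 0 j != 0 -> P v) -> for_general P.
Proof.
move=> hN hP; exists 1%N, (coord_form N j); split.
- rewrite /coord_form; apply: rpred_sum => i _; apply: dhomogZ.
  by rewrite dhomogX /= mdeg1.
- apply/negP => /eqP e; have := meval_coord_form N j (delta_mx 0 j *m invmx N).
  rewrite e mulmxKV // mxE !eqxx /evalv meval0 => /eqP.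
  by rewrite eq_sym oner_eq0.
- by move=> v _; rewrite meval_coord_form => /hP.
Qed.

Lemma exists_mem_trope L : \dim L = 2%N ->
  exists u, [/\ u \in L, u != 0 & crd u 0 = 0].
Proof.
move=> dL; have [e be] := exists_basis2 dL.
have eL i : tnth e i \in L by rewrite (basis_mem be) ?mem_tnth.
have [e0|e0] := eqVneq (crd (tnth e 0) 0) 0.
  exists (tnth e 0); split=> //.
  have := basis2_neq0 be; apply: contraNneq => ->.
  by apply/eqP/plucker_coordsP; rewrite /minor !mxE; split; ring.
(* The combination of the basis vectors that cancels the x-coordinate. *)
exists (crd (tnth e 1) 0 *: tnth e 0 - crd (tnth e 0) 0 *: tnth e 1); split.
- by rewrite rpredB ?rpredZ.
- have := basis2_neq0 be; apply: contraNneq => /eqP.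
  rewrite subr_eq0 => /eqP e1.
  have -> : tnth e 1 = (crd (tnth e 0) 0)^-1 *: (crd (tnth e 1) 0 *: tnth e 0).
    by rewrite e1 scalerK.
  rewrite scalerA; move: (_ * _) => a.
  by apply/eqP/plucker_coordsP; rewrite /minor !mxE; split; ring.
by rewrite -scaleNr crdD !crdZ; ring.
Qed.

(** A cone line through p off the trope plane meets that plane on the line x = y = 0, with z : w
    determined by p. *)
Lemma on_cone_crd L p u : on_cone M L -> p \in L -> u \in L ->
  crd p 0 != 0 -> crd u 0 = 0 ->
  crd u 1 = 0 /\ crd p 0 * crd u 3 + crd p 1 * crd u 2 = 0.
Proof.
case=> _ h pL uL p0 u0; have [] := h _ _ pL uL.
rewrite !minorM u0 !mulr0 !subr0 => /eqP.
rewrite mulf_eq0 (negPf p0) => /eqP u1; rewrite u1 mulr0 subr0; by split.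
Qed.

Lemma beta_plane_crd L p : beta_plane (kummer_trope M) L -> p \in L -> crd p 0 = 0.
Proof. by case=> _ /subvP h /h; rewrite trope_crd => /eqP. Qed.

Lemma sub_line_eq u v L : plucker_coords u v != 0 -> \dim L = 2%N ->
  u \in L -> v \in L -> L = <<[:: u; v]>>%VS.
Proof.
move=> /basis2_span[d _] dL uL vL; apply/esym/eqP; rewrite eqEdim d dL leqnn andbT.
by apply/span_subvP => x; rewrite !inE => /orP[] /eqP->.
Qed.

Lemma plucker_neq0 i j u v : minor i j (u *m M) (v *m M) != 0 ->
  plucker_coords u v != 0.
Proof.
apply: contra_neq => e; apply: minor_eq0.
by rewrite plucker_coords_mulmx e mul0mx.
Qed.

Lemma on_cone_span u v : plucker_coords u v != 0 ->
  minor 0 1 (u *m M) (v *m M) = 0 ->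
  minor 0 3 (u *m M) (v *m M) + minor 1 2 (u *m M) (v *m M) = 0 ->
  on_cone M <<[:: u; v]>>%VS.
Proof. by move=> /basis2_span[d b] m1 m2; apply: (on_cone_basis b). Qed.

(** * Order and class of the union of the trope plane and the cone *)

Section Bidegree.
Variable B : {vspace 'rV[k]_4} -> Prop.
Hypothesis BE : forall L, B L <-> beta_plane (kummer_trope M) L \/ on_cone M L.

(** A point off the trope plane is on no line of the beta-plane, and [on_cone_crd] fixes a second
    point of any cone line through it. *)
Lemma order_trope_cone :
  for_general (fun v => has_card (fun L => B L /\ v \in L) 1).
Proof.
apply: (@coord_form_general M 0) => // v; rewrite -/(crd v 0) => v0.
(* The solution of x_v w + y_v z = 0 on the line x = y = 0. *)
pose w := pt 0 0 (crd v 0) (- crd v 1).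
have vw0 : plucker_coords v w != 0.
  apply: (@plucker_neq0 0 2); rewrite !minorM !crd_pt mulr0 subr0.
  by rewrite mulf_neq0.
exists [:: <<[:: v; w]>>%VS]; split=> // L; rewrite inE; split=> [/eqP->|[]].
  split; last by rewrite memv_span ?mem_head.
  apply/BE; right; apply: on_cone_span => //; rewrite !minorM !crd_pt; ring.
move=> /BE[/beta_plane_crd h /h vx|]; first by rewrite vx eqxx in v0.
move=> cL vL; have dL := cL.1; apply/eqP/sub_line_eq => //.
have [u [uL u0 ux]] := exists_mem_trope dL.
have [uy uw] := on_cone_crd cL vL uL v0 ux.
have uz : crd u 2 != 0.
  apply: contraNneq u0 => uz; apply/eqP/crd_inj; rewrite crd0 //.
  by move/eqP: uw; rewrite uz mulr0 addr0 mulf_eq0 (negPf v0) => /eqP.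
suff -> : w = (crd v 0 / crd u 2) *: u by rewrite rpredZ.
apply: crd_inj; rewrite crdZ !crd_pt ?ux ?uy ?mulr0 ?mulfVK //.
move/eqP: uw; rewrite addr_eq0 => /eqP uw.
by rewrite mulrAC uw mulNr mulfK.
Qed.

(** A general plane meets the trope plane in one line and the line x = y = 0 in one point q. The
    cone lines through q fill the plane d_3 y = d_2 x, which cuts the given plane in one line; r is
    its point with z = 0. *)
Lemma class_trope_cone :
  for_general (fun h => has_card (fun L => B L /\ (L <= hyperplane h)%VS) 2).
Proof.
(* General means that the coefficient of w is nonzero: the plane misses (0 : 0 : 0 : 1). *)
apply: (@coord_form_general (invmx M)^T 3) => [|h].
  by rewrite unitmx_tr unitmx_inv.
have memU := mem_hyperplane_crd h; move: memU.
set d := fun j => (h *m (invmx M)^T) 0 j; rewrite -/(d 3) /= => memU d3.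
(* The line pq is the trace of the trope plane, and qr is the line of the cone. *)
pose q := pt 0 0 (d 3) (- d 2); pose p := pt 0 (d 3) 0 (- d 1).
pose r := pt (d 3 ^+ 2) (d 2 * d 3) 0 (- (d 0 * d 3 + d 1 * d 2)).
have pq0 : plucker_coords p q != 0.
  apply: (@plucker_neq0 1 2); rewrite !minorM !crd_pt mulr0 subr0.
  by rewrite mulf_neq0.
have qr0 : plucker_coords q r != 0.
  apply: (@plucker_neq0 0 2); rewrite !minorM !crd_pt mul0r sub0r.
  by rewrite oppr_eq0 mulf_neq0 ?expf_neq0.
have qU : q \in hyperplane h by rewrite memU !crd_pt; apply/eqP; ring.
have pU : p \in hyperplane h by rewrite memU !crd_pt; apply/eqP; ring.
have rU : r \in hyperplane h by rewrite memU !crd_pt; apply/eqP; ring.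
exists [:: <<[:: p; q]>>; <<[:: q; r]>>]%VS; split=> //.
  (* The two lines differ because r has x = d_3^2, so it is off the trope plane. *)
  rewrite /= inE andbT; apply/eqP => e.
  have : r \in <<[:: p; q]>>%VS by rewrite e memv_span ?inE ?eqxx ?orbT.
  have : (<<[:: p; q]>> <= kummer_trope M)%VS.
    by apply/span_subvP => x; rewrite !inE trope_crd => /orP[] /eqP->; rewrite crd_pt.
  by move/subvP=> s /s; rewrite trope_crd crd_pt expf_eq0 (negPf d3).
have bL L : \dim L = 2%N -> (L <= hyperplane h)%VS -> (L <= kummer_trope M)%VS ->
    L = <<[:: p; q]>>%VS.
  move=> dL /subvP LU /subvP LT; apply/eqP.
  rewrite eqEdim (basis2_span pq0).1 dL leqnn andbT.
  apply/subvP => v vL; have := LT v vL; rewrite trope_crd => /eqP vx.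
  have := LU v vL; rewrite memU vx mul0r add0r => /eqP e.
  have -> : v = (crd v 1 / d 3) *: p + (crd v 2 / d 3) *: q.
    apply: crd_inj; rewrite crdD !crdZ !crd_pt ?vx; [ring|field|field|] => //.
    have ew : crd v 3 * d 3 = - (crd v 1 * d 1 + crd v 2 * d 2).
      by apply/eqP; rewrite -addr_eq0 addrC e.
    by rewrite -[LHS](mulfK d3) ew; field.
  by rewrite rpredD ?rpredZ // memv_span // !inE eqxx ?orbT.
move=> L; rewrite !inE; split.
  case/orP => /eqP->; split.
  - apply/BE; left; split; first exact: (basis2_span pq0).1.
    by apply/span_subvP => x; rewrite !inE trope_crd => /orP[] /eqP->; rewrite crd_pt.
  - by apply/span_subvP => x; rewrite !inE => /orP[] /eqP->.
  - apply/BE; right; apply: on_cone_span => //; rewrite !minorM !crd_pt; ring.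
  - by apply/span_subvP => x; rewrite !inE => /orP[] /eqP->.
case=> /BE[[dL LT]|cL] LU; first by rewrite (bL L) ?eqxx.
(* A cone line inside the trope plane is already counted as pq. *)
have dL := cL.1; have [LT|] := boolP (L <= kummer_trope M)%VS.
  by rewrite (bL L) ?eqxx.
case/subvPn => v vL; rewrite trope_crd => v0.
suff -> : L = <<[:: q; r]>>%VS by rewrite eqxx orbT.
have [u [uL u0 ux]] := exists_mem_trope dL.
have [uy uw] := on_cone_crd cL vL uL v0 ux.
have /eqP := subvP LU u uL; rewrite memU ux uy !mul0r !add0r => /eqP /eqP uU.
have /eqP := subvP LU v vL; rewrite memU => /eqP /eqP vU.
have uz : crd u 2 != 0.
  apply: contraNneq u0 => uz; apply/eqP/crd_inj; rewrite crd0 //.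
  by move/eqP: uw; rewrite uz mulr0 addr0 mulf_eq0 (negPf v0) => /eqP.
have qL : q \in L.
  have -> : q = (d 3 / crd u 2) *: u.
    apply: crd_inj; rewrite crdZ !crd_pt ?ux ?uy ?mulr0 ?mulfVK //.
    move/eqP: uU; rewrite addrC addr_eq0 => /eqP uU.
    by rewrite mulrAC [d 3 * _]mulrC uU mulrC -mulrN mulKf.
  by rewrite rpredZ.
(* v lies in the plane of cone lines through q: combine the plane equation at u with the cone
   relation, then cancel the z-coordinate of u. *)
have vy : crd v 0 * d 2 = d 3 * crd v 1.
  apply: (mulIf uz); apply/eqP; rewrite -subr_eq0; apply/eqP.
  transitivity (crd v 0 * (crd u 2 * d 2 + crd u 3 * d 3)
    - d 3 * (crd v 0 * crd u 3 + crd v 1 * crd u 2)); first by ring.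
  by rewrite uU uw !mulr0 subr0.
apply: sub_line_eq => //.
(* Scale v to have x = d_3^2, then subtract the multiple of q that cancels z. *)
have -> : r = (d 3 ^+ 2 / crd v 0) *: v - (d 3 * crd v 2 / crd v 0) *: q.
  rewrite -scaleNr; apply: crd_inj; rewrite crdD !crdZ !crd_pt.
  - by field.
  - by rewrite -[d 2](mulKf v0) vy; field.
  - by field.
  - have e0 : crd v 0 * d 0 = - (crd v 1 * d 1 + crd v 2 * d 2 + crd v 3 * d 3).
      by apply/eqP; rewrite -addr_eq0 !addrA vU.
    by rewrite -[d 0](mulKf v0) e0 -[d 2](mulKf v0) vy; field.
by rewrite rpredB ?rpredZ.
Qed.

End Bidegree.
End Congruence.

(** * The plane x = 0 is a trope *)

Section Trope.
Variables (k : closedFieldType) (M : 'M[k]_4).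
Hypothesis hk : 2%N \in [pchar k].
Hypothesis hM : M \in unitmx.

(** At x = 0 the form is y^2 w^2 + z^4 = (y w - z^2)^2 in characteristic 2, the square of the same
    [conic], now in y, z, w. *)
Lemma trope_kummer al : trope (kummer_supersingular al M) (kummer_trope M).
Proof.
pose e : 3.-tuple 'rV[k]_4 := [tuple pt M 0 1 0 0; pt M 0 0 1 0; pt M 0 0 0 1].
have crd_sum (a : 'I_3 -> k) : let v := \sum_(i < 3) a i *: tnth e i in
    (crd M v 0 = 0) * (crd M v 1 = a 0) * (crd M v 2 = a 1) * (crd M v 3 = a 2).
  by rewrite /= sum_ord3; do !split; rewrite !crdD !crdZ !(crd_pt hM) //; ring.
have fe : free e.
  apply/freeP => a; under eq_bigr do rewrite -tnth_nth.
  move=> e0; have := crd_sum a; rewrite /= e0 !crd0 => -[[[_ a0] a1] a2].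
  exact: forall_ord3.
have se : <<e>>%VS = kummer_trope M.
  apply: subv_anti; apply/andP; split.
    apply/span_subvP => x; rewrite !inE (trope_crd M).
    by move=> /or3P[] /eqP->; rewrite (crd_pt hM).
  apply/subvP => v; rewrite (trope_crd M) => /eqP v0.
  pose a (i : 'I_3) := [:: crd M v 1; crd M v 2; crd M v 3]`_i.
  have -> : v = \sum_(i < 3) a i *: tnth e i.
    by apply: (crd_inj hM); rewrite crd_sum.
  by apply: rpred_sum => i _; rewrite rpredZ // memv_span ?mem_tnth.
have be : basis_of (kummer_trope M) e by rewrite /basis_of se eqxx.
exists e; first by split=> //; exact: vector.size_basis be.
exists 1, (conic k); split; [exact: oner_neq0 | exact: smooth_conic_conic |].
rewrite restrict_kummer scale1r !sum_ord3 /= -!/(crd M _ _) !(crd_pt hM).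
rewrite /kummer_form /conic mpolyC0 mpolyC1.
rewrite (oppr_pchar2 (pchar2_mpoly hk 3)) [RHS](sqrrD_pchar2 (pchar2_mpoly hk 3)).
by ring.
Qed.

End Trope.

Theorem theorem8p1 (k : closedFieldType) (hk : (2%N \in [pchar k]))
    (alpha : k) (M : 'M[k]_4) (hM : M \in unitmx) :
  let X0 := kummer_supersingular alpha M in
  let T := kummer_trope M in
  bidegree (bitangent X0) 1 2 /\
  trope X0 T /\
  exists Q : {vspace 'rV[k]_4} -> Prop,
    quadric_cone (plucker_image Q) /\
    (forall L, Q L -> \dim L = 2%N) /\
    (forall L, bitangent X0 L <-> beta_plane T L \/ Q L).
Proof.
move=> X0 T; have BE := bitangentE hk alpha M; split.
  by split; [apply: (order_trope_cone hM BE) | apply: (class_trope_cone hM BE)].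
split; first exact: trope_kummer.
exists (on_cone M); split; first exact: quadric_cone_on_cone.
by split=> [L []|].
Qed.
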